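(* Let $\Delta=p+1$, where $p$ is a prime with $p\equiv 1 \pmod 4$. Then there is an infinite sequence of connected $\Delta$-regular graphs, with strictly increasing numbers of vertices, such that for each graph $G$ in the sequence, writing $n=|V(G)|$, and for every $u\in V(G)$, $\mathbb{E}(T(G,u)) \ge \sqrt{n}/6$, where $T(G,u)$ is the self-intersection time of the non-backtracking random walk on $G$ started at $u$.
   Context: Graphs are finite, simple and undirected. For a connected graph $G$ with minimum degree at least $3$, the non-backtracking random walk (NBW) on $G$ from $u\in V(G)$ is the random process $(X_t)_{t\ge 0}$ with $X_0=u$, where $X_1$ is chosen uniformly from the set $N(X_0)$ of neighbours of $X_0$, and, for each $t\ge 2$, $X_t$ is chosen uniformly from $N(X_{t-1})\setminus\{X_{t-2}\}$ (conditionally on the past). The self-intersection time is $T(G,u):=\min\{t\ge 2 : X_t=X_j \text{ for some } j\in\{0,\ldots,t-1\}\}$. *)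

(* Defs.v *)
From HB Require Import structures.
From mathcomp Require Import all_boot all_order all_algebra.
From mathcomp Require Import all_classical all_reals all_analysis.

Set Implicit Arguments.
Unset Strict Implicit.
Unset Printing Implicit Defensive.

Import Order.TTheory GRing.Theory Num.Theory.

Local Open Scope ring_scope.

Record sgraph := SGraph {
  vertex :> finType;
  adj : rel vertex;
  adj_sym : symmetric adj;
  adj_irrefl : irreflexive adj }.

Definition nbhd (G : sgraph) (v : G) : {set G} := [set w | adj v w].

Definition regular_graph (d : nat) (G : sgraph) : Prop :=
  forall v : G, #|nbhd v| = d.

Definition connected_graph (G : sgraph) : Prop :=
  (0 < #|G|)%N /\ forall v w : G, connect (@adj G) v w.

(* The set from which the walk picks its position at time t.+1 when its
   trajectory up to time t is x 0, ..., x t (later values of x are not used). *)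
Definition nbw_choices (G : sgraph) (x : nat -> G) (t : nat) : {set G} :=
  if t is s.+1 then nbhd (x t) :\ x s else nbhd (x 0).

Section NonBacktrackingWalk.
Context {R : realType} (d : measure_display) (Omega : measurableType d).
Context (P : probability Omega R) (G : sgraph).
Implicit Types (X : nat -> Omega -> G) (x : nat -> G).

Definition trajectory_event X x (t : nat) : set Omega :=
  [set w | forall i, (i <= t)%N -> X i w = x i]%classic.

(* nbw_step is the conditional law of X_(t+1) given X_0, ..., X_t, multiplied
   out so that histories of probability zero need no separate treatment. *)
Record nonbacktracking_walk (u : G) X : Prop := NonBacktrackingWalk {
  nbw_measurable : forall t v, measurable (X t @^-1` [set v])%classic;
  nbw_start : P (X 0 @^-1` [set u])%classic = 1%E;
  nbw_step : forall x t,
    P (trajectory_event X x t.+1) =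
    (P (trajectory_event X x t) *
     ((x t.+1 \in nbw_choices x t)%:R / #|nbw_choices x t|%:R)%:E)%E }.

End NonBacktrackingWalk.

Definition self_intersects_at (V : finType) (x : nat -> V) (t : nat) : bool :=
  (2 <= t)%N && [exists j : 'I_t, x t == x j].

Lemma self_intersects (V : finType) (x : nat -> V) :
  exists t, self_intersects_at x t.
Proof.
pose f (i : 'I_#|V|.+1) := x i.+1.
have /injectivePn[i [j neq_ij eq_ij]] : ~~ injectiveb f.
  by apply/injectiveP => /leq_card; rewrite card_ord ltnn.
wlog lt_ij : i j neq_ij eq_ij / (i < j)%N => [wlog_ij|].
  case: (ltngtP i j) => [||/val_inj ij]; first exact: wlog_ij.
    by apply: wlog_ij; rewrite // eq_sym.
  by rewrite ij eqxx in neq_ij.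
exists j.+1; rewrite /self_intersects_at ltnS (leq_ltn_trans _ lt_ij) //=.
have lt_ij1 : (i.+1 < j.+1)%N by [].
by apply/existsP; exists (Ordinal lt_ij1); rewrite /= -/(f i) -/(f j) eq_ij.
Qed.

Definition self_intersection_time (V : finType) (x : nat -> V) : nat :=
  ex_minn (self_intersects x).

(* Main.v *)
Require Import Defs.
From HB Require Import structures.
From mathcomp Require Import all_boot all_order all_algebra.
From mathcomp Require Import all_classical all_reals all_analysis.
From mathcomp Require Import measurable_realfun.
From mathcomp Require Import ring lra zify.

Set Implicit Arguments.
Unset Strict Implicit.
Unset Printing Implicit Defensive.

Import Order.TTheory GRing.Theory Num.Theory.

Local Open Scope ring_scope.

(** The graphs come from an extremal principle instead of an arithmetic
construction.  Fix a large [L], put [n = 9 L^2] and choose [z] with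
[p z = 1 - 1/L].  Among all [(p+1)]-regular graphs on [n] vertices take one
that maximises the absolute value of the determinant of
[M = (1 + p z^2) I - z A], where [A] is the adjacency matrix.  By the Ihara-Bass
formula this amounts to minimising the zeta function of the graph at [z], that
is, a weighted count of its closed non-backtracking walks; the extremal graph
has so few of them that no vertex sees more than a bounded multiple of what an
ideal random graph would show.

Let [g] be the inverse of [M].  On a dart (an ordered pair of adjacent vertices)
[(x, y)], the quantity [g y v - z g x v] is the expected number of visits to [v]
of the non-backtracking walk that has just stepped from [x] to [y], when every
step survives with probability [p z] (lemma [dart_greenE]).  Hence
[vertex_excess v = (1 - z^2) g v v - 1], which is [0] on the infinite tree,
measures the returns to [v], and [edge_excess] plays the same role for edges.

Replacing the edges [ab], [cd] by [ac], [bd] changes [A] by a matrix of rank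
two, so the determinant changes by an explicit factor in the entries of [g]
([det_rank_two_update]), and maximality says that this factor is at most [1].
This bounds the edge excess of [ab] by somewhat less than the average of the
vertex excesses at its ends, up to terms which become [O(L/n) = O(1/L)] when
averaged over all [cd] ([switch_gain_far], [switch_sum]).  Since vertex excesses
are at most averages of edge excesses, the edge with the largest excess then
forces all excesses to be at most [1/(L+1)] ([stable_vertex_excess_le]).

On the side of the walk, if [T] is the self-intersection time then
[T >= L - sum over i < j < L of (L - j) [X_i = X_j]]: when [T < L], the pair
formed by [T] and the earlier time of the visit already contributes [L - T].
By Bernoulli's inequality the weight [L - j] is at most
[(L - i) (p z)^(j - i)], so for each [i] the expected sum over [j] is at most
[L - i] times the maximal vertex excess.  Therefore
[E T >= L - (L (L+1) / 2) / (L+1) = L/2 = sqrt n / 6].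

Connectedness costs nothing: the bound only gets weaker when [n] is replaced by
the size of a connected component, and the total mass of [g] shows that every
component has at least [L/2] vertices ([green_card]). *)

(** * Resolvent and Green function of a regular graph *)

Lemma nbhd_sym (G : sgraph) (x y : G) : (x \in nbhd y) = (y \in nbhd x).
Proof. by rewrite !inE adj_sym. Qed.

Section DartSums.
Context (R : comNzRingType) (G : sgraph) (p : nat).
Hypothesis G_reg : regular_graph p.+1 G.

Lemma sum_darts_fst (F : G -> R) :
  \sum_x \sum_(w in nbhd x) F x = p.+1%:R * \sum_x F x.
Proof.
rewrite mulr_sumr; apply: eq_bigr => x _.
by rewrite sumr_const G_reg mulr_natl.
Qed.

Lemma sum_darts_snd (F : G -> R) :
  \sum_x \sum_(w in nbhd x) F w = p.+1%:R * \sum_x F x.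
Proof.
rewrite -sum_darts_fst (exchange_big_dep predT) //=.
by apply: eq_bigr => w _; apply: eq_bigl => x; rewrite nbhd_sym.
Qed.

Lemma sum_darts_affine (w : R) (F : G -> G -> R) (F1 F2 : G -> R) :
  \sum_x \sum_(y in nbhd x) (w + F x y - F1 x - F2 y) =
  p.+1%:R * (#|G|%:R * w - \sum_x F1 x - \sum_x F2 x) +
  \sum_x \sum_(y in nbhd x) F x y.
Proof.
under eq_bigr do rewrite !big_split /= !sumrN.
rewrite !big_split /= !sumrN (sum_darts_fst F1) (sum_darts_snd F2).
rewrite (sum_darts_fst (fun=> w)) sumr_const -[w *+ _]mulr_natl; ring.
Qed.

End DartSums.

Section Green.
Context (R : realFieldType) (G : sgraph) (p : nat) (z : R).
Hypothesis G_reg : regular_graph p.+1 G.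
Hypotheses (p_gt0 : (0 < p)%N) (z_gt0 : 0 < z) (pz_lt1 : p%:R * z < 1).

(** The operator [(1 + p z^2) I - z A] of the Ihara-Bass formula. *)
Definition resolvent (f : G -> R) (x : G) : R :=
  (1 + p%:R * z ^+ 2) * f x - z * \sum_(w in nbhd x) f w.

Definition is_green (g : G -> G -> R) : Prop :=
  forall x v, resolvent (g^~ v) x = (x == v)%:R.

Lemma z_lt1 : z < 1.
Proof.
have : (1 : R) <= p%:R by rewrite ler1n.
by move: z_gt0 pz_lt1; nra.
Qed.

(** The norm of [A] is at most [p + 1], and
[1 + p z^2 - (p + 1) z = (1 - z) (1 - p z)]; so the operator is positive
definite as long as [p z < 1]. *)
Lemma energy_ge (f : G -> R) :
  (1 - z) * (1 - p%:R * z) * \sum_x f x ^+ 2 <= \sum_x f x * resolvent f x.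
Proof.
have cross : \sum_x \sum_(w in nbhd x) f x * f w <=
             p.+1%:R * \sum_x f x ^+ 2.
  have -> : p.+1%:R * \sum_x f x ^+ 2 =
      \sum_x \sum_(w in nbhd x) (f x ^+ 2 / 2 + f w ^+ 2 / 2).
    under [RHS]eq_bigr do rewrite big_split /=.
    rewrite big_split /= (sum_darts_fst G_reg (fun x => f x ^+ 2 / 2)).
    rewrite (sum_darts_snd G_reg (fun x => f x ^+ 2 / 2)) -mulr_suml; by field.
  apply: ler_sum => x _; apply: ler_sum => w _.
  have := sqr_ge0 (f x - f w); lra.
have -> : \sum_x f x * resolvent f x =
    (1 + p%:R * z ^+ 2) * (\sum_x f x ^+ 2) -
    z * \sum_x \sum_(w in nbhd x) f x * f w.
  rewrite !mulr_sumr -sumrB; apply: eq_bigr => x _.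
  by rewrite /resolvent -mulr_sumr; ring.
have := ler_wpM2l (ltW z_gt0) cross; rewrite -natr1; lra.
Qed.

Lemma resolvent_inj0 (f : G -> R) : (forall x, resolvent f x = 0) ->
  forall x, f x = 0.
Proof.
move=> f0 x; have := energy_ge f.
rewrite [X in _ <= X]big1 => [|y _]; last by rewrite f0 mulr0.
rewrite pmulr_rle0; last by have := z_lt1; move: pz_lt1; nra.
move=> le0; have /eqP : \sum_x f x ^+ 2 = 0.
  by apply/eqP; rewrite eq_le le0 sumr_ge0 // => y _; exact: sqr_ge0.
rewrite psumr_eq0 => [/allP /(_ x)|y _]; last exact: sqr_ge0.
by rewrite mem_index_enum sqrf_eq0 => /(_ isT) /eqP.
Qed.

Context (g : G -> G -> R).
Hypothesis g_green : is_green g.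

(** The discounted number of visits to [v] of a non-backtracking walk that has
just crossed the dart [(x, y)]; [dart_greenE] is its first-step equation.  In
terms of [g]: all walks from [y], less those whose first step goes back to
[x]. *)
Definition dart_green (v x y : G) : R := g y v - z * g x v.

Lemma dart_greenE v x y : adj x y ->
  dart_green v x y =
  (y == v)%:R + z * \sum_(w in nbhd y :\ x) dart_green v y w.
Proof.
move=> xy; have := g_green y v; rewrite /resolvent.
have xNy : x \in nbhd y by rewrite inE adj_sym.
have cardN : #|nbhd y :\ x| = p.
  by have := cardsD1 x (nbhd y); rewrite G_reg xNy add1n => -[].
rewrite (big_setD1 x) //= => <-; rewrite /dart_green sumrB sumr_const cardN.
rewrite -mulr_natl; ring.
Qed.

(** Minimum principle: at the dart where the function is smallest, the
first-step equation gives [m >= p z m], and [p z < 1]. *)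
Lemma dart_green_ge0 v x y : adj x y -> 0 <= dart_green v x y.
Proof.
move=> xy; pose H (d : G * G) := dart_green v d.1 d.2.
have [[x0 y0] /= xy0 Hmin] :=
  @arg_minP _ _ _ (x, y) (fun d : G * G => adj d.1 d.2) H xy.
apply: le_trans (Hmin (x, y) xy); rewrite /H /=.
set m := dart_green v x0 y0.
have : p%:R * m <= \sum_(w in nbhd y0 :\ x0) dart_green v y0 w.
  have xNy : x0 \in nbhd y0 by rewrite inE adj_sym.
  have cardN : #|nbhd y0 :\ x0| = p.
    by have := cardsD1 x0 (nbhd y0); rewrite G_reg xNy add1n => -[].
  rewrite mulr_natl -cardN -sumr_const; apply: ler_sum => w.
  by rewrite !inE => /andP[_ yw]; exact: (Hmin (y0, w)).
move=> /(ler_wpM2l (ltW z_gt0)) le_m.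
have mE := dart_greenE v xy0; rewrite -/m in mE.
have ge0 : (0 : R) <= (y0 == v)%:R by rewrite ler0n.
rewrite leNgt; apply/negP => m_lt0; move: pz_lt1; nra.
Qed.

(** Splitting the walks from [x] according to their first step; [(1 - z^2) g] is
the generating function of the non-backtracking walks. *)
Lemma green_darts x v :
  (1 - z ^+ 2) * g x v = (x == v)%:R + z * \sum_(w in nbhd x) dart_green v x w.
Proof.
have := g_green x v; rewrite /resolvent => <-.
rewrite /dart_green sumrB sumr_const G_reg -[(z * g x v) *+ _]mulr_natl -natr1.
ring.
Qed.

Lemma one_sub_sqr_gt0 : 0 < 1 - z ^+ 2.
Proof. by have := z_lt1; move: z_gt0; nra. Qed.

Lemma sum_dart_green_ge0 v x :
  0 <= z * \sum_(w in nbhd x) dart_green v x w.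
Proof.
apply: mulr_ge0 (ltW z_gt0) (sumr_ge0 _ _) => w.
by rewrite inE; exact: dart_green_ge0.
Qed.

Lemma green_ge0 x v : 0 <= g x v.
Proof.
rewrite -(pmulr_rge0 _ one_sub_sqr_gt0) green_darts addr_ge0 ?ler0n //.
exact: sum_dart_green_ge0.
Qed.

(** On the infinite [(p+1)]-regular tree, [(1 - z^2) g] is [1] on the diagonal
and [z] on edges; the excesses are the contributions of cycles. *)
Definition vertex_excess v := (1 - z ^+ 2) * g v v - 1.
Definition edge_excess a b := (1 - z ^+ 2) * g a b - z.

Lemma vertex_excessE v :
  vertex_excess v = z * \sum_(w in nbhd v) dart_green v v w.
Proof. by rewrite /vertex_excess green_darts eqxx addrC addKr. Qed.

Lemma vertex_excess_ge0 v : 0 <= vertex_excess v.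
Proof. by rewrite vertex_excessE sum_dart_green_ge0. Qed.

Lemma dart_green_ge1 a b : adj a b -> 1 <= dart_green b a b.
Proof.
move=> ab; rewrite dart_greenE // eqxx lerDl.
apply: mulr_ge0 (ltW z_gt0) (sumr_ge0 _ _) => w.
by rewrite !inE => /andP[_]; exact: dart_green_ge0.
Qed.

Lemma edge_excess_ge0 a b : adj a b -> 0 <= edge_excess a b.
Proof.
move=> ab; rewrite subr_ge0 green_darts.
have [aE|_] := eqVneq a b; first by rewrite aE adj_irrefl in ab.
rewrite add0r ler_peMr ?(ltW z_gt0) // (big_setD1 b) ?inE //=.
rewrite (le_trans (dart_green_ge1 ab)) // lerDl sumr_ge0 // => w.
by rewrite !inE => /andP[_]; exact: dart_green_ge0.
Qed.

(** The vertex excess is nearly the mean of the excesses of the incident edges: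
as [z] approaches [1/p], the factor [z / (1 + p z^2)] approaches
[1 / (p + 1)]. *)
Lemma vertex_excess_sum v :
  (1 + p%:R * z ^+ 2) * vertex_excess v =
  z * \sum_(w in nbhd v) edge_excess w v.
Proof.
have := g_green v v; rewrite eqxx /resolvent /edge_excess sumrB -mulr_sumr.
rewrite sumr_const G_reg -[z *+ _]mulr_natl -natr1 /vertex_excess.
set s := \sum_(_ in _) _ => gE.
have -> : z * ((1 - z ^+ 2) * s - (p%:R + 1) * z) =
  (1 - z ^+ 2) * (z * s) - (p%:R + 1) * z ^+ 2 by ring.
have -> : z * s = (1 + p%:R * z ^+ 2) * g v v - 1 by move: gE => /=; lra.
ring.
Qed.

Lemma resolvent_coef_gt0 : 0 < (1 - z) * (1 - p%:R * z).
Proof. by have := z_lt1; move: pz_lt1; nra. Qed.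

(** Positivity of the quadratic form of [g] at the difference of two unit
vectors, obtained by applying [energy_ge] to the corresponding difference of
columns of [g]. *)
Lemma green_polarization a b : g a b + g b a <= g a a + g b b.
Proof.
have := energy_ge (fun x => g x a - g x b).
have -> : \sum_x (g x a - g x b) * resolvent (fun x => g x a - g x b) x =
    g a a - g a b - (g b a - g b b).
  have E x : resolvent (fun x => g x a - g x b) x = (x == a)%:R - (x == b)%:R.
    by rewrite -!g_green /resolvent sumrB; ring.
  under eq_bigr do rewrite E mulrBr.
  rewrite sumrB (bigD1 a) //= eqxx mulr1 big1 ?addr0 => [|x /negPf ->].
    rewrite (bigD1 b) //= eqxx mulr1 big1 ?addr0 => [|x /negPf ->] //.
    by rewrite mulr0.
  by rewrite mulr0.
move=> le_E; have : 0 <= g a a - g a b - (g b a - g b b).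
  apply: le_trans le_E; apply: mulr_ge0 (ltW resolvent_coef_gt0) _.
  by apply: sumr_ge0 => x _; exact: sqr_ge0.
lra.
Qed.

Lemma green_mass v : (1 - z) * (1 - p%:R * z) * \sum_x g x v = 1.
Proof.
have sum1 : \sum_x ((x == v)%:R : R) = 1.
  by rewrite (bigD1 v) //= eqxx big1 ?addr0 // => x /negPf ->.
rewrite -[RHS]sum1; under [RHS]eq_bigr do rewrite -g_green /resolvent.
rewrite sumrB -!mulr_sumr (sum_darts_snd G_reg (g^~ v)) -natr1; ring.
Qed.

(** Maximum principle: away from [v], each entry of a column of [g] is the mean
of the neighbouring entries times a factor less than [1]. *)
Lemma green_diag_max x v : g x v <= g v v.
Proof.
have [x0 _ gmax] := @arg_maxP _ _ _ v predT (g^~ v) isT.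
apply: le_trans (gmax x isT) _.
have [-> //|neq_x0v] := eqVneq x0 v.
have := g_green x0 v; rewrite (negPf neq_x0v) /resolvent => /eqP.
rewrite subr_eq0 => /eqP gE.
have /(ler_wpM2l (ltW z_gt0)) :
    \sum_(w in nbhd x0) g w v <= p.+1%:R * g x0 v.
  rewrite mulr_natl -(G_reg x0) -sumr_const.
  by apply: ler_sum => w _; exact: gmax.
rewrite -gE -natr1 => le_g.
have := resolvent_coef_gt0; have := green_ge0 v v; nra.
Qed.

(** The total mass of a column of [g] is large and its entries are at most
[g v v], so a graph with a small vertex excess cannot be small. *)
Lemma green_card v :
  1 + z <= #|G|%:R * (1 - p%:R * z) * (1 + vertex_excess v).
Proof.
have le_sum : \sum_x g x v <= #|G|%:R * g v v.
  rewrite mulr_natl -sumr_const; apply: ler_sum => x _; exact: green_diag_max.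
rewrite /vertex_excess [1 + (_ - 1)]addrC subrK.
have -> : 1 + z = (1 - z ^+ 2) * (1 - p%:R * z) * \sum_x g x v.
  by rewrite -[LHS]mulr1 -[X in _ * X](green_mass v); ring.
rewrite -(ler_pM2l (_ : 0 < (1 - z ^+ 2) * (1 - p%:R * z))) in le_sum.
  apply: le_trans le_sum _; rewrite le_eqVlt; apply/orP; left; apply/eqP.
  ring.
by rewrite mulr_gt0 ?one_sub_sqr_gt0 // subr_gt0.
Qed.

End Green.

(** * Excesses of a graph that no switch improves *)

(** The quadratic inequality produced by a switch, solved for its gain [h].  To
first order in [s] it says [h <= 2 z / (1 + z^2) s], and [z <= 1/5] makes the
slope smaller than [1/2]; beyond [s = 1] the slope may approach [1], but the
saving [1/2] won on the way is never lost.  So the saving is at least [m / 2]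
for every [m] below both [s] and [1]. *)
Lemma switch_gain_le (R : realFieldType) (z h s m : R) :
  0 < z -> z <= 5^-1 -> 0 <= m -> m <= s -> m <= 1 ->
  (1 + z ^+ 2 + z * h) ^+ 2 <=
    (1 + z ^+ 2) ^+ 2 + z ^+ 2 * (4 * s + s ^+ 2) ->
  h <= s - m / 2.
Proof.
move=> z0 z5 m0 ms m1 hyp; rewrite leNgt; apply/negP => lt_h.
have lt_sq : (1 + z ^+ 2 + z * (s - m / 2)) ^+ 2 < (1 + z ^+ 2 + z * h) ^+ 2.
  rewrite ltr_pXn2r ?nnegrE //; nra.
have {lt_sq} := lt_le_trans lt_sq hyp.
have -> : (1 + z ^+ 2 + z * (s - m / 2)) ^+ 2 =
    (1 + z ^+ 2) ^+ 2 + z ^+ 2 * (4 * s + s ^+ 2) +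
    z * (2 * (s - m) * (1 + z ^+ 2 - 2 * z - z * m / 2) +
         m * (1 + z ^+ 2 - 4 * z - 3 * z * m / 4)).
  by field.
have pos1 : 0 <= 1 + z ^+ 2 - 2 * z - z * m / 2 by nra.
have pos2 : 0 <= 1 + z ^+ 2 - 4 * z - 3 * z * m / 4 by nra.
rewrite gtrDl pmulr_rlt0 // => lt0.
have sm : 0 <= s - m by rewrite subr_ge0.
have := mulr_ge0 sm pos1; have := mulr_ge0 m0 pos2; lra.
Qed.

Section Extremal.
Context (R : realFieldType) (G : sgraph) (p : nat) (z : R) (g : G -> G -> R).
Hypothesis G_reg : regular_graph p.+1 G.
Hypotheses (p_ge5 : (4 < p)%N) (z_gt0 : 0 < z) (pz_lt1 : p%:R * z < 1).
Hypothesis g_green : is_green p z g.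
Hypothesis g_sym : forall x y, g x y = g y x.

Let p_gt0 : (0 < p)%N. Proof. exact: leq_trans p_ge5. Qed.
Let z_le5 : z <= 5^-1.
Proof.
have : (5 : R) <= p%:R by rewrite ler_nat.
by move: z_gt0 pz_lt1; nra.
Qed.

Definition within_one (x y : G) : bool := (y == x) || adj x y.

(** Replacing the edges [ab] and [cd] by [ac] and [bd] multiplies the
determinant of the resolvent by the left-hand side below. *)
Definition switch_stable : Prop := forall a b c d : G,
  adj a b -> adj c d -> ~~ within_one a c -> ~~ within_one b d ->
  (1 - z * (g a c - g a b - g d c + g d b)) ^+ 2 -
    z ^+ 2 * ((g a a + g d d - 2 * g a d) * (g c c + g b b - 2 * g c b)) <= 1.

Hypothesis stable : switch_stable.

Let k := 1 - z ^+ 2.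
Let k_gt0 : 0 < k. Proof. exact: one_sub_sqr_gt0 p_gt0 z_gt0 pz_lt1. Qed.
Let ve := vertex_excess z g.
Let ee := edge_excess z g.

Let ve_ge0 v : 0 <= ve v.
Proof. exact: (vertex_excess_ge0 G_reg z_gt0 pz_lt1 g_green). Qed.
Let ee_ge0 a b : adj a b -> 0 <= ee a b.
Proof. exact: (edge_excess_ge0 G_reg z_gt0 pz_lt1 g_green). Qed.
Let g_ge0 a b : 0 <= g a b.
Proof. exact: (green_ge0 G_reg p_gt0 z_gt0 pz_lt1 g_green). Qed.
Let g_polar a b : 2 * g a b <= g a a + g b b.
Proof.
have := green_polarization G_reg p_gt0 z_gt0 pz_lt1 g_green a b.
by rewrite (g_sym b a); lra.
Qed.

Definition switch_gain a b c d := ee a b + ee c d - k * g a c - k * g b d.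
Definition switch_loss a b c d := (ve a + ve b + ve c + ve d) / 2.

(** Expressed through the excesses, stability says
[(1 + z^2 + z gain)^2 <= (1 - z^2)^2 + z^2 (2 + loss)^2]: up to the factor
[1 - z^2], each of the two diagonal terms in [switch_stable] is at most [2] plus
the sum of two vertex excesses, and the arithmetic-geometric inequality bounds
their product. *)
Lemma switch_gain_far a b c d m :
  adj a b -> adj c d -> ~~ within_one a c -> ~~ within_one b d ->
  0 <= m -> m <= 1 -> m <= (ve a + ve b) / 2 ->
  switch_gain a b c d <= switch_loss a b c d - m / 2.
Proof.
move=> ab cd ac bd m0 m1 mab.
apply: switch_gain_le z_gt0 z_le5 m0 _ m1 _.
  by rewrite /switch_loss; have := ve_ge0 c; have := ve_ge0 d; lra.
have := stable ab cd ac bd.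
set al := g a c - _ - _ + _; set X := g a a + _ - _; set Y := g c c + _ - _.
rewrite -(ler_pM2l (_ : 0 < k ^+ 2)) ?exprn_gt0 // mulr1.
have X0 : 0 <= k * X by rewrite mulr_ge0 ?(ltW k_gt0) // subr_ge0 g_polar.
have Y0 : 0 <= k * Y by rewrite mulr_ge0 ?(ltW k_gt0) // subr_ge0 g_polar.
have XY : (k * X) * (k * Y) <= (2 + switch_loss a b c d) ^+ 2.
  have leX : k * X <= 2 + ve a + ve d.
    have := mulr_ge0 (ltW k_gt0) (g_ge0 a d).
    by rewrite /X /ve /vertex_excess -/k; lra.
  have leY : k * Y <= 2 + ve b + ve c.
    have := mulr_ge0 (ltW k_gt0) (g_ge0 c b).
    by rewrite /Y /ve /vertex_excess -/k; lra.
  apply: le_trans (ler_pM X0 Y0 leX leY) _.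
  have := sqr_ge0 ((2 + ve a + ve d) - (2 + ve b + ve c)).
  by rewrite /switch_loss; lra.
move=> le_k2.
have : (k - z * (k * al)) ^+ 2 <= k ^+ 2 + z ^+ 2 * ((k * X) * (k * Y)) by lra.
have -> : k - z * (k * al) = 1 + z ^+ 2 + z * switch_gain a b c d.
  by rewrite /switch_gain /al /ee /edge_excess (g_sym d c) (g_sym d b) /k; ring.
move=> /le_trans; apply.
have := ler_wpM2l (sqr_ge0 z) XY; rewrite /k; lra.
Qed.

(** The darts [cd] too close to [ab] for a switch are few; for them positivity
of the form [g] gives a crude bound, which is enough. *)
Lemma switch_gain_near a b c d : switch_gain a b c d <= switch_loss a b c d + 2.
Proof.
have kg a' b' : 0 <= k * g a' b' by rewrite mulr_ge0 ?(ltW k_gt0).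
have le_ee a' b' : ee a' b' <= (ve a' + ve b') / 2 + 1.
  have := ler_wpM2l (ltW k_gt0) (g_polar a' b').
  by rewrite /ee /ve /edge_excess /vertex_excess -/k; move: z_gt0; lra.
have := le_ee a b; have := le_ee c d; have := kg a c; have := kg b d.
rewrite /switch_gain /switch_loss; lra.
Qed.

Lemma sum_ve_le : p.+1%:R * \sum_x ve x <= \sum_x \sum_(w in nbhd x) ee x w.
Proof.
rewrite mulr_sumr; apply: ler_sum => x _.
have := vertex_excess_sum G_reg g_green x; rewrite -/ve.
under eq_bigr do rewrite /edge_excess g_sym -/(edge_excess z g x _) -/ee.
set s := \sum_(_ in _) _ => sE; rewrite -(ler_pM2l z_gt0) -sE -natr1.
rewrite mulrA ler_wpM2r //.
have := resolvent_coef_gt0 p_gt0 z_gt0 pz_lt1; lra.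
Qed.

Lemma ve_le_max (eta : R) :
  (forall x y, adj x y -> ee x y <= eta) -> forall x, ve x <= eta.
Proof.
move=> ee_le x.
have := vertex_excess_sum G_reg g_green x; rewrite -/ve.
have : \sum_(w in nbhd x) ee w x <= p.+1%:R * eta.
  rewrite mulr_natl -(G_reg x) -sumr_const; apply: ler_sum => w.
  by rewrite inE adj_sym => /ee_le.
move=> /(ler_wpM2l (ltW z_gt0)) le_s sE; move: le_s; rewrite -{}sE -natr1.
have := resolvent_coef_gt0 p_gt0 z_gt0 pz_lt1.
have [w xw] : exists w, adj x w.
  have /card_gt0P[w] : (0 < #|nbhd x|)%N by rewrite G_reg.
  by rewrite inE; exists w.
have eta0 : 0 <= eta by apply: le_trans (ee_le _ _ xw); exact: ee_ge0.
move=> c0 le_v; rewrite leNgt; apply/negP => lt_v.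
have : 0 < 1 + p%:R * z ^+ 2 by rewrite ltr_wpDr // mulr_ge0 ?ler0n ?sqr_ge0.
nra.
Qed.

Lemma card_within_one x : #|[set y | within_one x y]| = p.+2.
Proof.
have -> : [set y | within_one x y] = x |: nbhd x.
  by apply/setP => y; rewrite !inE.
by rewrite cardsU1 G_reg inE adj_irrefl.
Qed.

Lemma sum_within_one x : \sum_y (within_one x y)%:R = p.+2%:R :> R.
Proof.
rewrite -(card_within_one x) -sum1_card natr_sum [RHS]big_mkcond /=.
by apply: eq_bigr => y _; rewrite inE; case: within_one.
Qed.

(** Summing [switch_gain_far] over all darts [cd].  The terms [g a c] and
[g b d] add up to the mass of two columns, and the excesses of [cd] can be
dropped because their sum on the side of the gain dominates the one on the side
of the loss, by [sum_ve_le]. *)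
Lemma switch_sum a b m :
  adj a b -> 0 <= m -> m <= 1 -> m <= (ve a + ve b) / 2 ->
  (1 - p%:R * z) * #|G|%:R * (ee a b - (ve a + ve b) / 2 + m / 2) <=
  2 * (1 + z) + 5 * (1 - p%:R * z) * p.+2%:R.
Proof.
move=> ab m0 m1 mab.
have pz0 : 0 < 1 - p%:R * z by rewrite subr_gt0.
have p0 : (0 : R) < p.+1%:R by rewrite ltr0n.
have mass v : (1 - p%:R * z) * \sum_x k * g v x = 1 + z.
  rewrite -mulr_sumr; under eq_bigr do rewrite g_sym.
  rewrite -[RHS]mulr1 -[X in _ = _ * X](green_mass G_reg g_green v) /k; ring.
(* On a near dart the gain exceeds the loss by at most [2], and [m / 2] by at
   most [1 / 2] more; hence the weight [5 / 2]. *)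
have : \sum_c \sum_(d in nbhd c)
    (switch_gain a b c d - switch_loss a b c d + m / 2) <=
  \sum_c \sum_(d in nbhd c)
    (5 / 2 * (within_one a c)%:R + 5 / 2 * (within_one b d)%:R).
  apply: ler_sum => c _; apply: ler_sum => d; rewrite inE => cd.
  have [ac|ac] := boolP (within_one a c);
    last have [bd|bd] := boolP (within_one b d).
  - have := switch_gain_near a b c d; have := ler0n R (within_one b d).
    by rewrite mulr1n; lra.
  - by have := switch_gain_near a b c d; rewrite mulr1n mulr0n; lra.
  - by have := switch_gain_far ab cd ac bd m0 m1 mab; rewrite mulr0n; lra.
under [X in _ <= X]eq_bigr do rewrite big_split /=.
rewrite big_split /=.
rewrite (sum_darts_fst G_reg (fun c => 5 / 2 * (within_one a c)%:R)).
rewrite (sum_darts_snd G_reg (fun d => 5 / 2 * (within_one b d)%:R)).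
rewrite -!mulr_sumr !sum_within_one.
have -> : \sum_c \sum_(d in nbhd c)
      (switch_gain a b c d - switch_loss a b c d + m / 2) =
    p.+1%:R * (#|G|%:R * (ee a b - (ve a + ve b) / 2 + m / 2)
      - \sum_x k * g a x - \sum_x k * g b x - \sum_x ve x)
    + \sum_x \sum_(w in nbhd x) ee x w.
  have E v : \sum_x (k * g v x + ve x / 2) =
      \sum_x k * g v x + (\sum_x ve x) / 2.
    by rewrite [in RHS]mulr_suml -big_split.
  transitivity (\sum_c \sum_(d in nbhd c)
      ((ee a b - (ve a + ve b) / 2 + m / 2) + ee c d
       - (k * g a c + ve c / 2) - (k * g b d + ve d / 2))).
    apply: eq_bigr => c _; apply: eq_bigr => d _.
    by rewrite /switch_gain /switch_loss; lra.
  by rewrite (sum_darts_affine G_reg) !E; field.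
have := sum_ve_le; have := mass a; have := mass b.
set Sa := \sum_x _ * g a x; set Sb := \sum_x _ * g b x.
set V := \sum_x ve x; set E := \sum_x _.
set W := _ - _ + m / 2; set N := #|G|%:R => massb massa leE le1.
have : N * W <= Sa + Sb + 5 * p.+2%:R.
  rewrite -(ler_pM2l p0); lra.
move=> /(ler_wpM2l (ltW pz0)); lra.
Qed.

(** Apply [switch_sum] to the edge [ab] with the largest excess [eta].  Its loss
[s = (ve a + ve b) / 2] is at most [eta], and [eta - s + min(s, 1) / 2] is at
most [29 / (90 L)].  If [s >= 1] this quantity would be at least [1 / 2]; hence
[s < 1] and it is at least [eta / 2]. *)
Lemma stable_vertex_excess_le (L : nat) :
  (10 * p.+2 <= L)%N -> 1 - p%:R * z = L%:R^-1 ->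
  #|G|%:R = 9 * L%:R ^+ 2 :> R ->
  forall x, vertex_excess z g x <= (L%:R + 1)^-1.
Proof.
move=> L_ge pzE cardG x.
have [y xy] : exists y, adj x y.
  have /card_gt0P[y] : (0 < #|nbhd x|)%N by rewrite G_reg.
  by rewrite inE; exists y.
have [[a b] /= ab ee_max] := @arg_maxP _ _ _ (x, y)
  (fun d : G * G => adj d.1 d.2) (fun d => ee d.1 d.2) xy.
have {}ee_max c d : adj c d -> ee c d <= ee a b.
  by move=> cd; exact: (ee_max (c, d)).
have ve_le := ve_le_max ee_max; apply: le_trans (ve_le x) _.
have LR : 10 * p.+2%:R <= L%:R :> R by rewrite -natrM ler_nat.
have p2 : 7 <= p.+2%:R :> R by rewrite ler_nat.
set l := L%:R in pzE cardG LR *; set s := (ve a + ve b) / 2.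
have l0 : 0 < l by lra.
have s_le : s <= ee a b by rewrite /s; have := ve_le a; have := ve_le b; lra.
have s_ge0 : 0 <= s by rewrite /s; have := ve_ge0 a; have := ve_ge0 b; lra.
have key m : 0 <= m -> m <= 1 -> m <= s ->
    9 * l * (ee a b - s + m / 2) <= 29 / 10.
  move=> m0 m1 ms; have := switch_sum ab m0 m1 ms.
  rewrite pzE cardG.
  have -> : l^-1 * (9 * l ^+ 2) * (ee a b - (ve a + ve b) / 2 + m / 2) =
    9 * l * (ee a b - s + m / 2) by rewrite /s; field; rewrite gt_eqF.
  move=> /le_trans; apply.
  (* The darts close to [ab] weigh at most [1/2], against [2 (1 + z) <= 2.4]. *)
  have : 5 * l^-1 * p.+2%:R <= 1 / 2.
    by rewrite mulrAC ler_pdivrMr //; lra.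
  by move: z_le5; lra.
have s_lt1 : s < 1.
  rewrite ltNge; apply/negP => s1.
  have := key 1 ler01 (lexx _) s1; nra.
have le_e := key s s_ge0 (ltW s_lt1) (lexx _).
rewrite -[(l + 1)^-1]div1r ler_pdivlMr; last lra.
have ls : 0 <= l * (ee a b - s) by rewrite mulr_ge0 ?subr_ge0 // ltW.
have l7 : 0 <= (l - 70) * ee a b by rewrite mulr_ge0 ?ee_ge0 //; lra.
lra.
Qed.

End Extremal.

(** * The determinant of a switched graph *)

(** Sylvester's identity: both sides are the determinant of the block matrix
with rows [(1, U)] and [(W, 1)]. *)
Lemma det_one_sub_mulmxC (R : comNzRingType) m n
    (U : 'M[R]_(m, n)) (W : 'M[R]_(n, m)) :
  \det (1%:M - U *m W) = \det (1%:M - W *m U).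
Proof.
have E1 : block_mx 1%:M U W 1%:M *m block_mx 1%:M 0 (- W) 1%:M =
    block_mx (1%:M - U *m W) U 0 1%:M.
  by rewrite mulmx_block !mulmx1 !mul1mx !mulmx0 !add0r mulmxN subrr.
have E2 : block_mx 1%:M 0 (- W) 1%:M *m block_mx 1%:M U W 1%:M =
    block_mx 1%:M U 0 (1%:M - W *m U).
  rewrite mulmx_block !mulmx1 !mul1mx !mul0mx !addr0 mulNmx.
  by rewrite addNr addrC.
have := congr1 determinant E1; have := congr1 determinant E2.
rewrite !det_mulmx !det_ublock det_lblock !det1 !mul1r !mulr1.
by move=> -> ->.
Qed.

Lemma det_mx2 (R : comNzRingType) (A : 'M[R]_2) :
  \det A = A 0 0 * A 1 1 - A 0 1 * A 1 0.
Proof.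
rewrite (expand_det_row _ 0) !big_ord_recl big_ord0 /cofactor !det_mx11 !mxE /=.
rewrite expr0 expr1 addr0 mul1r mulN1r mulrN.
by congr (_ * A _ _ - A _ _ * A _ _); apply/val_inj.
Qed.

(** The perturbation is a product of an [n x 2] and a [2 x n] matrix, so that
Sylvester's identity leaves a determinant of order two, whose entries are values
of the bilinear form [q] of the inverse of [M]. *)
Lemma det_rank_two_update (R : fieldType) n (M : 'M[R]_n) (u v : 'cV[R]_n)
    (c : R) (q : 'cV[R]_n -> 'cV[R]_n -> R) :
  M \in unitmx -> (forall s t, q s t = (s^T *m invmx M *m t) 0 0) ->
  \det (M - c *: (u *m v^T + v *m u^T)) =
  \det M * ((1 - c * q v u) * (1 - c * q u v) - c ^+ 2 * (q v v * q u u)).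
Proof.
move=> uM qE; set g := invmx M in qE.
pose U : 'M[R]_(n, 1 + 1) := c *: (g *m row_mx u v).
pose W : 'M[R]_(1 + 1, n) := col_mx v^T u^T.
have -> : M - c *: (u *m v^T + v *m u^T) = M *m (1%:M - U *m W).
  rewrite mulmxBr mulmx1 /U -scalemxAl -scalemxAr -mulmxA mulKVmx //.
  by rewrite /W mul_row_col.
rewrite det_mulmx det_one_sub_mulmxC; congr (_ * _).
have WU : W *m U = c *: block_mx (v^T *m g *m u) (v^T *m g *m v)
                               (u^T *m g *m u) (u^T *m g *m v).
  by rewrite /W /U -scalemxAr mulmxA mul_col_mx mul_col_row.
rewrite WU (det_mx2 (1%:M - _ : 'M[R]_2)) !qE.
have o0 : 0 = lshift 1 0 :> 'I_(1 + 1) by apply/val_inj.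
have o1 : 1 = rshift 1 0 :> 'I_(1 + 1) by apply/val_inj.
set X := block_mx _ _ _ _.
have X00 : X 0 0 = (v^T *m g *m u) 0 0 by rewrite {1}o0 {1}o0 block_mxEul.
have X01 : X 0 1 = (v^T *m g *m v) 0 0 by rewrite {1}o0 o1 block_mxEur.
have X10 : X 1 0 = (u^T *m g *m u) 0 0 by rewrite o1 {1}o0 block_mxEdl.
have X11 : X 1 1 = (u^T *m g *m v) 0 0 by rewrite o1 block_mxEdr.
have E i j : (1%:M - c *: X) i j = (i == j)%:R - c * X i j by rewrite !mxE.
rewrite !{}E X00 X01 X10 X11 /=; ring.
Qed.

Section Switching.
Context (R : realFieldType) (n p : nat) (z : R).
Hypotheses (p_gt0 : (0 < p)%N) (z_gt0 : 0 < z) (pz_lt1 : p%:R * z < 1).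

(** Graphs on [n] vertices as elements of a finite type, so that a maximiser of
the determinant exists. *)
Definition edge_table := {ffun 'I_n * 'I_n -> bool}.
Implicit Types (e : edge_table).

Definition is_regular_table e : bool :=
  [&& [forall x, forall y, e (x, y) == e (y, x)], [forall x, ~~ e (x, x)]
    & [forall x, #|[set y | e (x, y)]| == p.+1]].

Lemma is_regular_tableP e :
  reflect [/\ forall x y, e (x, y) = e (y, x), forall x, e (x, x) = false
            & forall x, #|[set y | e (x, y)]| = p.+1]
          (is_regular_table e).
Proof.
apply: (iffP and3P) => -[sym irr reg]; split.
- by move=> x y; apply/eqP; have /forallP/(_ x)/forallP := sym.
- by move=> x; apply/negbTE; have /forallP := irr.
- by move=> x; apply/eqP; have /forallP := reg.
- by apply/forallP => x; apply/forallP => y; rewrite sym.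
- by apply/forallP => x; rewrite irr.
- by apply/forallP => x; rewrite reg.
Qed.

Definition adjacency_mx e : 'M[R]_n := \matrix_(i, j) (e (i, j))%:R.
Definition resolvent_mx e := (1 + p%:R * z ^+ 2)%:M - z *: adjacency_mx e.

Definition switch_table e a b c d : edge_table :=
  [ffun ij => (e ij && (ij \notin [:: (a, b); (b, a); (c, d); (d, c)]))
              || (ij \in [:: (a, c); (c, a); (b, d); (d, b)])].

Definition basis_vec (a : 'I_n) : 'cV[R]_n := \col_i (i == a)%:R.

Section Switch.
Context (e : edge_table) (a b c d : 'I_n).
Hypothesis e_reg : is_regular_table e.
Hypotheses (ab : e (a, b)) (cd : e (c, d)).
Hypotheses (ac : a != c) (nac : ~~ e (a, c)) (bd : b != d) (nbd : ~~ e (b, d)).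

Let u := basis_vec a - basis_vec d.
Let v := basis_vec c - basis_vec b.

(** With [u = e_a - e_d] and [v = e_c - e_b], the product [u v^T] has entries
[+1] at [ac], [db] and [-1] at [ab], [dc]; the transpose takes care of the
reversed pairs. *)
Lemma adjacency_mx_switch :
  adjacency_mx (switch_table e a b c d) =
  adjacency_mx e + (u *m v^T + v *m u^T).
Proof.
have [sym irr _] := is_regular_tableP _ e_reg.
have ba : e (b, a) by rewrite sym.
have dc : e (d, c) by rewrite sym.
have nca : ~~ e (c, a) by rewrite sym.
have ndb : ~~ e (d, b) by rewrite sym.
have nab : a != b by apply: contraTneq ab => ->; rewrite irr.
have ncd : c != d by apply: contraTneq cd => ->; rewrite irr.
have nad : a != d by apply: contraTneq dc => <-.
have nbc : b != c by apply: contraTneq cd => <-.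
(* The four vertices are distinct, so the identity can be checked for each
   position of [i] and [j] among them. *)
have neqs := (negPf nab, negPf ncd, negPf nad, negPf nbc, negPf ac, negPf bd,
  eq_sym b a, eq_sym d c, eq_sym d a, eq_sym c b, eq_sym c a, eq_sym d b).
have vals := (negPf nac, negPf nca, negPf nbd, negPf ndb, ab, ba, cd, dc, irr).
apply/matrixP => i j; rewrite !mxE !big_ord_recl !big_ord0 !mxE !ffunE.
rewrite !inE !xpair_eqE.
have [->|ia] := eqVneq i a; [|have [->|ib] := eqVneq i b;
  [|have [->|ic] := eqVneq i c; [|have [->|id] := eqVneq i d]]];
(have [->|ja] := eqVneq j a; [|have [->|jb] := eqVneq j b;
  [|have [->|jc] := eqVneq j c; [|have [->|jd] := eqVneq j d]]]);
rewrite ?eqxx ?neqs ?vals /= ?andbT ?orbF; try ring.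
Qed.

Lemma switch_table_regular : is_regular_table (switch_table e a b c d).
Proof.
have [sym irr reg] := is_regular_tableP _ e_reg.
apply/is_regular_tableP; split.
- move=> x y; rewrite !ffunE sym !inE !xpair_eqE.
  rewrite ![(x == _) && _]andbC.
  by do !case: (_ == _); rewrite ?orbT ?andbF //=.
- move=> x; rewrite !ffunE irr /= !inE !xpair_eqE.
  have off s t : s != t -> ((x == s) && (x == t)) = false.
    by move=> st; apply/negbTE; apply: contra st => /andP[/eqP <-].
  by rewrite (off a c) ?(off c a) ?(off b d) ?(off d b) // eq_sym.
- move=> x; apply/eqP; rewrite -(eqr_nat R) -(reg x) -!sum1_card !natr_sum.
  have rowE e' : \sum_(y in [set y | e' (x, y)]) 1%:R =
      \sum_y adjacency_mx e' x y :> R.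
    rewrite big_mkcond; apply: eq_bigr => y _.
    by rewrite inE mxE; case: (e' _).
  rewrite !rowE adjacency_mx_switch.
  under eq_bigr do rewrite mxE.
  rewrite big_split /= [X in _ + X](_ : _ = 0) ?addr0 //.
  have vec_sum w w' : \sum_j (basis_vec w - basis_vec w') j 0 = 0.
    under eq_bigr do rewrite !mxE.
    rewrite sumrB; apply/eqP; rewrite subr_eq0; apply/eqP.
    rewrite (bigD1 w) //= eqxx big1 ?addr0 => [|y /negPf ->] //.
    by rewrite (bigD1 w') //= eqxx big1 ?addr0 => [|y /negPf ->].
  under eq_bigr do rewrite !mxE !big_ord_recl !big_ord0 !addr0
     [v^T _ _]mxE [u^T _ _]mxE.
  by rewrite big_split /= -!mulr_sumr !vec_sum !mulr0 addr0.
Qed.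

End Switch.

Section TableGraph.
Context (e : edge_table).
Hypothesis e_reg : is_regular_table e.

Let table_sym : symmetric (fun x y => e (x, y)).
Proof. by move=> x y; have [-> _ _] := is_regular_tableP _ e_reg. Qed.

Let table_irrefl : irreflexive (fun x y => e (x, y)).
Proof. by move=> x; have [_ -> _] := is_regular_tableP _ e_reg. Qed.

Definition table_graph : sgraph := SGraph table_sym table_irrefl.

Lemma table_graph_regular : regular_graph p.+1 table_graph.
Proof.
by move=> x; have [_ _ reg] := is_regular_tableP _ e_reg; exact: reg.
Qed.

Lemma resolvent_mx_tr : (resolvent_mx e)^T = resolvent_mx e.
Proof.
apply/matrixP => i j; rewrite !mxE eq_sym.
by have [-> _ _] := is_regular_tableP _ e_reg.
Qed.

Lemma resolvent_mxE m (A : 'M[R]_(n, m)) i j :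
  (resolvent_mx e *m A) i j =
  @resolvent R table_graph p z (fun x => A x j) i.
Proof.
rewrite mulmxBl mul_scalar_mx -scalemxAl !mxE /resolvent; congr (_ - _ * _).
rewrite [RHS]big_mkcond; apply: eq_bigr => w _.
by rewrite mxE !inE /=; case: (e _); rewrite ?mul1r ?mul0r.
Qed.

Lemma resolvent_mx_unit : resolvent_mx e \in unitmx.
Proof.
rewrite unitmxE unitfE; apply/det0P => -[w w_neq0 wM].
case/eqP: w_neq0; apply/rowP => i; rewrite mxE.
apply: (resolvent_inj0 table_graph_regular p_gt0 z_gt0 pz_lt1 (f := w 0)).
move=> x; have := resolvent_mxE w^T x 0.
rewrite -resolvent_mx_tr -trmx_mul wM !mxE /= => /esym.
by rewrite /resolvent mxE; under eq_bigr do rewrite mxE.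
Qed.

Definition table_green (x y : table_graph) : R := invmx (resolvent_mx e) x y.

Lemma table_greenP : is_green p z table_green.
Proof.
move=> x v; rewrite -(resolvent_mxE (invmx (resolvent_mx e))).
by rewrite mulmxV ?resolvent_mx_unit // mxE.
Qed.

Lemma table_green_sym x y : table_green x y = table_green y x.
Proof. by rewrite /table_green -{1}resolvent_mx_tr -trmx_inv mxE. Qed.

End TableGraph.

Lemma quad_basis_vec (A : 'M[R]_n) s s' t t' :
  ((basis_vec s - basis_vec s')^T *m A *m (basis_vec t - basis_vec t')) 0 0 =
  A s t - A s t' - A s' t + A s' t'.
Proof.
have tr_basis w : (basis_vec w)^T = delta_mx 0 w.
  by apply/matrixP => i j; rewrite !mxE ord1 eqxx.
have basisE w : basis_vec w = delta_mx w 0.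
  by apply/matrixP => i j; rewrite !mxE ord1 eqxx andbT.
rewrite [(_ - _)^T]linearB /= !tr_basis mulmxBl -!rowE mulmxBr !mulmxBl.
rewrite !basisE -!colE.
rewrite !mxE; ring.
Qed.

(** The absolute value of the determinant is maximised, rather than the
determinant, so that its sign need not be known: the maximum is nonzero because
[resolvent_mx] is always invertible. *)
Lemma extremal_table_stable (e0 : edge_table) : is_regular_table e0 ->
  exists e, exists e_reg : is_regular_table e,
    switch_stable z (@table_green e e_reg).
Proof.
move=> e0_reg.
have [e e_reg e_max] := @arg_maxP _ _ _ e0 is_regular_table
  (fun e => `|\det (resolvent_mx e)|) e0_reg.
exists e, e_reg => a b c d /= ab cd.
rewrite /within_one !negb_or /= ![_ == a]eq_sym ![_ == b]eq_sym.
case/andP=> ac nac /andP[bd nbd].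
have := e_max _ (switch_table_regular e_reg ab cd ac nac bd nbd).
rewrite /resolvent_mx (adjacency_mx_switch e_reg ab cd ac nac bd nbd).
rewrite scalerDr opprD addrA -/(resolvent_mx e).
set u := _ - basis_vec d; set v := _ - basis_vec b.
pose q s t := (s^T *m invmx (resolvent_mx e) *m t : 'M[R]_1) 0 0.
have det_neq0 : \det (resolvent_mx e) != 0.
  by rewrite -unitfE -unitmxE resolvent_mx_unit.
rewrite (@det_rank_two_update _ _ _ u v z q) ?resolvent_mx_unit // normrM.
rewrite /= -[leRHS]mulr1 ler_pM2l ?normr_gt0 // => le1.
have -> : 1 - z * (table_green a c - table_green a b -
    table_green d c + table_green d b) = 1 - z * q u v.
  by rewrite /q quad_basis_vec.
have g_sym (x y : 'I_n) :
    invmx (resolvent_mx e) x y = invmx (resolvent_mx e) y x.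
  exact: (table_green_sym (e_reg := e_reg)).
have qC : q v u = q u v.
  rewrite /q !quad_basis_vec (g_sym c a) (g_sym c d) (g_sym b a) (g_sym b d).
  ring.
rewrite qC in le1.
apply: le_trans (le_trans (ler_norm _) le1).
rewrite le_eqVlt; apply/orP; left; apply/eqP.
rewrite -expr2; congr (_ - _ ^+ 2 * _).
rewrite /q !quad_basis_vec /table_green (g_sym d a) (g_sym b c); ring.
Qed.

End Switching.

(** * Returns of the walk and the self-intersection time *)

(** If the walk first meets itself at a time [t < L], the pair made of [t] and
the time of the earlier visit contributes [L - t] to the sum; the truncated
subtraction discards the pairs that end after time [L]. *)
Lemma self_intersection_time_lower (V : finType) (x : nat -> V) (L : nat) :
  (L <= self_intersection_time x +
        \sum_(k : 'I_L * 'I_L)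
          (x (k.1.+1 + k.2) == x k.1) * (L - (k.1.+1 + k.2)))%N.
Proof.
rewrite /self_intersection_time; case: ex_minnP => t /andP[_ /existsP[j xt]] _.
have [Lt|tL] := leqP L t; first exact: leq_trans Lt (leq_addr _ _).
have jL : (j < L)%N by apply: ltn_trans tL.
have sL : (t - j.+1 < L)%N by apply: leq_ltn_trans tL; exact: leq_subr.
rewrite (bigD1 (Ordinal jL, Ordinal sL)) //= subnKC // xt mul1n.
by rewrite addnA subnKC ?leq_addr // ltnW.
Qed.

(** Bernoulli's inequality turns a linear cutoff at [l <= L] into the geometric
survival probability [1 - 1/L]. *)
Lemma bernoulli_weight (R : realFieldType) (L l s : nat) :
  (0 < L)%N -> (l <= L)%N ->
  (l - s)%:R <= l%:R * (1 - L%:R^-1) ^+ s :> R.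
Proof.
move=> L0 lL; have LR : 0 < L%:R :> R by rewrite ltr0n.
have q0 : 0 <= 1 - L%:R^-1 :> R by rewrite subr_ge0 invf_le1 // ler1n.
elim: s => [|s IHs]; first by rewrite subn0 expr0 mulr1.
have [ls|sl] := leqP l s.
  have -> : (l - s.+1 = 0)%N by apply/eqP; rewrite subn_eq0 (leq_trans ls).
  by rewrite mulr_ge0 ?exprn_ge0.
rewrite exprS mulrCA; apply: le_trans (ler_wpM2l q0 IHs).
have le1 : (l - s)%:R * L%:R^-1 <= 1 :> R.
  by rewrite ler_pdivrMr // mul1r ler_nat (leq_trans (leq_subr _ _)).
have lsE : (l - s)%:R = (l - s.+1)%:R + 1 :> R by rewrite natr1 subnSK.
lra.
Qed.

Section WalkProbability.
Context (R : realType) (G : sgraph) (p : nat) (z : R) (g : G -> G -> R).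
Hypothesis G_reg : regular_graph p.+1 G.
Hypotheses (p_gt0 : (0 < p)%N) (z_gt0 : 0 < z) (pz_lt1 : p%:R * z < 1).
Hypothesis g_green : is_green p z g.
Context (d : measure_display) (Omega : measurableType d).
Context (P : probability Omega R) (u : G) (X : nat -> Omega -> G).
Hypothesis X_nbw : nonbacktracking_walk P u X.

Implicit Types (x : nat -> G).
Local Open Scope classical_set_scope.

Let pr (A : set Omega) : R := fine (P A).

Let prE A : measurable A -> P A = (pr A)%:E.
Proof. by move=> mA; rewrite fineK // fin_num_measure. Qed.

Let pr_ge0 A : 0 <= pr A.
Proof. exact: fine_ge0. Qed.

Let pr_le A B : measurable A -> measurable B -> A `<=` B -> pr A <= pr B.
Proof.
by move=> mA mB AB; rewrite -lee_fin -!prE // le_measure // inE.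
Qed.

Let mX t v : measurable (X t @^-1` [set v]).
Proof. exact: (nbw_measurable X_nbw). Qed.

Let meq s t : measurable [set w | X s w = X t w].
Proof.
have -> : [set w | X s w = X t w] =
    \big[setU/set0]_(v : G) (X s @^-1` [set v] `&` X t @^-1` [set v]).
  apply/seteqP; split => w /=.
    move=> st; rewrite -bigcup_seq; exists (X t w) => //=.
    exact: mem_index_enum.
  by rewrite -bigcup_seq => -[v _ /= [-> ->]].
by apply: bigsetU_measurable => v _; exact: measurableI.
Qed.

Let mtraj x t : measurable (trajectory_event X x t).
Proof.
have -> : trajectory_event X x t =
    \bigcap_(i in [set i | (i <= t)%N]) X i @^-1` [set x i].
  by apply/seteqP; split => w.
exact: bigcap_measurableType.
Qed.

Let pr_split t A : measurable A -> pr A = \sum_v pr (A `&` X t @^-1` [set v]).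
Proof.
move=> mA; have mAv v : measurable (A `&` X t @^-1` [set v]).
  exact: measurableI.
have split_seq (s : seq G) : uniq s ->
    pr (A `&` [set w | X t w \in s]) =
      \sum_(v <- s) pr (A `&` X t @^-1` [set v]) /\
    measurable (A `&` [set w | X t w \in s]).
  elim: s => [_|v s IHs /= /andP[vs us]].
    have -> : A `&` [set w | X t w \in [::]] = set0.
      by apply/seteqP; split=> w //= [].
    by rewrite big_nil /pr measure0.
  have {IHs us} [IHs ms] := IHs us.
  have -> : A `&` [set w | X t w \in v :: s] =
      (A `&` X t @^-1` [set v]) `|` (A `&` [set w | X t w \in s]).
    apply/seteqP; split => w /=.
      by move=> [Aw]; rewrite inE => /orP[/eqP Xv|Xs]; [left|right].
    move=> [[Aw ->]|[Aw Xs]]; split=> //; first exact: mem_head.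
    by rewrite inE Xs orbT.
  split; last exact: measurableU.
  rewrite big_cons -IHs /pr measureU //; last first.
    apply/seteqP; split=> w //= [[_ Xv] [_]].
    by rewrite Xv (negPf vs).
  by rewrite fineD ?fin_num_measure.
have [<- _] := split_seq (index_enum G) (index_enum_uniq G).
by congr pr; apply/seteqP; split=> w //= => [Aw|[]]; rewrite ?mem_index_enum.
Qed.

Let upd (x : nat -> G) t v : nat -> G := fun i => if i == t then v else x i.

Let traj_upd x t v :
  trajectory_event X (upd x t.+1 v) t.+1 =
  trajectory_event X x t `&` X t.+1 @^-1` [set v].
Proof.
apply/seteqP; split=> w /=.
  move=> tr; split=> [i it|].
    by rewrite tr ?leqW // /upd ltn_eqF.
  by rewrite /= tr // /upd eqxx.
move=> [tr Xv] i; rewrite /upd; case: eqVneq => [-> _ //|neq].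
by rewrite leq_eqVlt (negPf neq) => /tr.
Qed.

Let choices_sub x t v : v \in nbw_choices x t -> adj (x t) v.
Proof. by case: t => [|t]; rewrite !inE // => /andP[]. Qed.

Let choices_card x t : (p <= #|nbw_choices x t|)%N.
Proof.
case: t => [|t] /=; first by rewrite G_reg.
have := cardsD1 (x t) (nbhd (x t.+1)).
by rewrite G_reg; case: (_ \in _) => /=; lia.
Qed.

Let pr_step x t v :
  pr (trajectory_event X x t `&` X t.+1 @^-1` [set v]) <=
  pr (trajectory_event X x t) / p%:R * (v \in nbw_choices x t)%:R.
Proof.
rewrite -traj_upd /pr (nbw_step X_nbw).
have -> : trajectory_event X (upd x t.+1 v) t = trajectory_event X x t.
  by apply/seteqP; split=> w tr i it; rewrite tr // /upd ltn_eqF.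
have -> : nbw_choices (upd x t.+1 v) t = nbw_choices x t.
  by case: t => [|t] //=; rewrite /upd !ltn_eqF.
rewrite {1}/upd eqxx (prE (mtraj x t)) -EFinM /= -mulrA.
rewrite ler_wpM2l // mulrC ler_wpM2r // lef_pV2 ?posrE ?ltr0n ?ler_nat //.
exact: leq_trans (choices_card x t).
Qed.

Let q := p%:R * z.
Let q_ge0 : 0 <= q. Proof. by rewrite mulr_ge0 // ltW. Qed.

(** The dart Green function bounds the discounted visits after any history that
ends with the step from [x t] to [x t.+1].  The horizon [S] is finite, so that
the bound can be proved by induction on [S], the first-step equation of
[dart_green] providing the induction step. *)
Let visits_bound S := forall x t v, adj (x t) (x t.+1) ->
  \sum_(s < S) q ^+ s *
     pr (trajectory_event X x t.+1 `&` X (t.+1 + s)%N @^-1` [set v]) <=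
  pr (trajectory_event X x t.+1) * dart_green z g v (x t) (x t.+1).

Let visits_next S x t v : visits_bound S ->
  \sum_(s < S) q ^+ s *
     pr (trajectory_event X x t `&` X (t.+1 + s)%N @^-1` [set v]) <=
  pr (trajectory_event X x t) / p%:R *
     \sum_(w in nbw_choices x t) dart_green z g v (x t) w.
Proof.
move=> bound.
under eq_bigr => s _.
  rewrite (pr_split t.+1); last exact: measurableI.
  rewrite mulr_sumr; over.
rewrite exchange_big /= mulr_sumr [leRHS]big_mkcond /=.
apply: ler_sum => w _.
have E s : trajectory_event X x t `&` X (t.+1 + s)%N @^-1` [set v] `&`
      X t.+1 @^-1` [set w] =
    trajectory_event X (upd x t.+1 w) t.+1 `&` X (t.+1 + s)%N @^-1` [set v].
  by rewrite traj_upd setIAC.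
under eq_bigr do rewrite E.
have le_step := pr_step x t w.
case: ifPn => wC; rewrite -traj_upd in le_step.
  have xw : adj (x t) w by exact: choices_sub wC.
  have xE : upd x t.+1 w t = x t by rewrite /upd ltn_eqF.
  have wE : upd x t.+1 w t.+1 = w by rewrite /upd eqxx.
  apply: le_trans (bound _ _ _ _) _; rewrite xE wE //.
  rewrite ler_wpM2r ?(dart_green_ge0 G_reg) //.
  by rewrite wC mulr1 in le_step.
rewrite (negPf wC) mulr0 in le_step.
rewrite big1 // => s _; rewrite [pr _](_ : _ = 0) ?mulr0 //.
apply: le_anti; rewrite pr_ge0 andbT; apply: le_trans le_step.
apply: pr_le => //; first exact: measurableI.
Qed.

Let visits_le S : visits_bound S.
Proof.
elim: S => [|S IHS] x t v xt.
  by rewrite big_ord0 mulr_ge0 ?(dart_green_ge0 G_reg).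
rewrite big_ord_recl expr0 mul1r addn0 (dart_greenE G_reg) // mulrDr.
apply: lerD.
  case: eqVneq => [xv|neq].
    by rewrite mulr1; apply: pr_le; [exact: measurableI| |move=> ? []].
  rewrite mulr0 [X in pr X](_ : _ = set0) ?/pr ?measure0 //.
  by apply/seteqP; split=> w //= [tr Xv]; case/eqP: neq; rewrite -Xv tr.
under eq_bigr do rewrite lift0 exprS -mulrA addnS -addSn.
rewrite -mulr_sumr; apply: le_trans (ler_wpM2l q_ge0 (visits_next _ _ _ IHS)) _.
rewrite le_eqVlt; apply/orP; left; apply/eqP; rewrite /q /=.
by field; rewrite pnatr_eq0 -lt0n.
Qed.

Let returns_from S x t :
  \sum_(s < S) q ^+ s.+1 *
     pr (trajectory_event X x t `&` X (t.+1 + s)%N @^-1` [set x t]) <=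
  pr (trajectory_event X x t) * vertex_excess z g (x t).
Proof.
under eq_bigr do rewrite exprS -mulrA.
rewrite -mulr_sumr.
apply: le_trans (ler_wpM2l q_ge0 (visits_next _ _ _ (@visits_le S))) _.
rewrite (vertex_excessE G_reg) //.
have -> : q * (pr (trajectory_event X x t) / p%:R *
   \sum_(w in nbw_choices x t) dart_green z g (x t) (x t) w) =
   pr (trajectory_event X x t) * (z *
   \sum_(w in nbw_choices x t) dart_green z g (x t) (x t) w).
  by rewrite /q; field; rewrite pnatr_eq0 -lt0n.
rewrite ler_wpM2l // ler_wpM2l ?(ltW z_gt0) //.
rewrite [leLHS]big_mkcond [leRHS]big_mkcond; apply: ler_sum => w _.
case: ifPn => [/choices_sub xw|_]; first by rewrite inE xw.
by rewrite inE; case: ifP => // /(dart_green_ge0 G_reg); exact.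
Qed.

Context (eps : R).
Hypothesis eps_ge : forall v, vertex_excess z g v <= eps.

(** The bound of [returns_from] holds after every history of length [i], hence
after every shorter one, by conditioning on one more step at a time. *)
Let returns_after S i t x : (t <= i)%N ->
  \sum_(s < S) q ^+ s.+1 *
     pr (trajectory_event X x t `&` [set w | X (i.+1 + s)%N w = X i w]) <=
  pr (trajectory_event X x t) * eps.
Proof.
move=> /subnK; move: (i - t)%N => k <-.
elim: k t x => [|k IHk] t x; rewrite ?add0n.
  apply: le_trans (ler_wpM2l (pr_ge0 _) (eps_ge (x t))).
  apply: le_trans (returns_from S x t); apply: ler_sum => s _.
  rewrite [X in _ * pr X](_ : _ = trajectory_event X x t `&`
     X (t.+1 + s)%N @^-1` [set x t]) //.
  by apply/seteqP; split=> w /= [tr Xt]; split=> //; rewrite Xt tr.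
rewrite addSnnS; under eq_bigr => s _.
  rewrite (pr_split t.+1); last exact: measurableI.
  rewrite mulr_sumr; over.
rewrite exchange_big /= [pr _](pr_split t.+1) // mulr_suml.
apply: ler_sum => v _; rewrite -traj_upd; apply: le_trans (IHk _ _).
by apply: ler_sum => s _; rewrite setIAC -traj_upd.
Qed.

Let returns_le S i :
  \sum_(s < S) q ^+ s.+1 * pr [set w | X (i.+1 + s)%N w = X i w] <= eps.
Proof.
under eq_bigr => s _.
  rewrite (pr_split 0%N) //.
  rewrite mulr_sumr; over.
rewrite exchange_big /=.
have -> : eps = \sum_v pr (setT `&` X 0%N @^-1` [set v]) * eps.
  by rewrite -mulr_suml -pr_split // /pr probability_setT /= mul1r.
apply: ler_sum => v _; rewrite setTI.
have E : X 0%N @^-1` [set v] = trajectory_event X (fun=> v) 0.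
  apply/seteqP; split=> w /=; last exact.
  by move=> Xv i0; rewrite leqn0 => /eqP ->.
rewrite E; apply: le_trans (returns_after S (fun=> v) (leq0n i)).
by apply: ler_sum => s _; rewrite setIC.
Qed.

Let time w := self_intersection_time (fun t => X t w).

Let mtime t : measurable [set w | time w = t].
Proof.
have msi s : measurable [set w | self_intersects_at (fun t => X t w) s].
  rewrite /self_intersects_at; have [_|_] /= := leqP 2 s; last first.
    rewrite [X in measurable X](_ : _ = set0) //.
    by apply/seteqP; split.
  rewrite [X in measurable X](_ : _ =
      \big[setU/set0]_(j : 'I_s) [set w | X s w = X j w]).
    exact: bigsetU_measurable.
  apply/seteqP; split=> w /=; rewrite -bigcup_seq.
    by move=> /existsP[j /eqP Xj]; exists j => //=; rewrite mem_index_enum.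
  by move=> [j _ /= Xj]; apply/existsP; exists j; apply/eqP.
have -> : [set w | time w = t] =
    [set w | self_intersects_at (fun t => X t w) t] `&`
    \bigcap_(s in [set s | (s < t)%N])
      ~` [set w | self_intersects_at (fun t => X t w) s].
  apply/seteqP; split=> w /=; rewrite /time /self_intersection_time;
    case: ex_minnP => m mP m_min.
    move=> <-; split=> // s /= sm si; by have := m_min _ si; rewrite leqNgt sm.
  move=> [tP t_min]; apply/eqP; rewrite eqn_leq m_min //= leqNgt.
  by apply/negP => mt; exact: (t_min m mt mP).
apply: measurableI => //.
by apply: bigcap_measurableType => s _; exact: measurableC.
Qed.

Let mtimeR : measurable_fun setT (fun w => (time w)%:R : R).
Proof.
move=> _ B mB; rewrite setTI.
have -> : (fun w => (time w)%:R : R) @^-1` B =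
    \bigcup_(t in [set t | B t%:R]) [set w | time w = t].
  apply/seteqP; split=> w /=; first by move=> Bw; exists (time w).
  by move=> [t Bt ->].
exact: bigcup_measurable.
Qed.

(** Taking expectations in [self_intersection_time_lower]; for each [i] the
return bound [eps] is multiplied by at most [L - i], and the sum of these
factors is [L (L + 1) / 2]. *)
Lemma expected_self_intersection_time_ge (L : nat) :
  (0 < L)%N -> q = 1 - L%:R^-1 -> (L%:R + 1) * eps <= 1 ->
  ((L%:R / 2)%:E <=
     'E_P[fun w => (self_intersection_time (fun t => X t w))%:R])%E.
Proof.
move=> L0 qE epsL.
pose wt (k : 'I_L * 'I_L) : R := (L - (k.1.+1 + k.2))%:R.
pose E (k : 'I_L * 'I_L) := [set w | X (k.1.+1 + k.2)%N w = X k.1 w].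
have mE k : measurable (E k) by exact: meq.
have eps0 : 0 <= eps.
  by apply: le_trans (eps_ge u); exact: (vertex_excess_ge0 G_reg).
have weight_le : \sum_k wt k * pr (E k) <= L%:R / 2.
  rewrite -(pair_bigA _ (fun i j : 'I_L => wt (i, j) * pr (E (i, j)))) /=.
  have tri (l : nat) : \sum_(i < l) (l - i)%:R = l%:R * (l%:R + 1) / 2 :> R.
    elim: l => [|l IHl]; first by rewrite big_ord0 !mul0r.
    rewrite big_ord_recl subn0; under eq_bigr do rewrite lift0 subSS.
    by rewrite IHl -natr1; field.
  apply: (@le_trans _ _ (\sum_(i < L) (L - i)%:R * eps)).
    apply: ler_sum => i _.
    apply: le_trans (ler_wpM2l (ler0n _ _) (returns_le L i)).
    rewrite mulr_sumr; apply: ler_sum => s _; rewrite mulrA ler_wpM2r //.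
    rewrite /wt /= addSnnS subnDA qE; apply: bernoulli_weight => //.
    exact: leq_subr.
  have LR : 0 <= L%:R :> R by rewrite ler0n.
  rewrite -mulr_suml tri; nra.
have mterm k : measurable_fun setT (fun w => (wt k * \1_(E k) w)%:E).
  apply/measurable_EFinP; apply: measurable_funM; first exact: measurable_cst.
  exact: measurable_indic.
have int_time : (L%:R%:E <= 'E_P[fun w => (time w)%:R] +
    \sum_k (wt k * pr (E k))%:E)%E.
  have -> : (\sum_k (wt k * pr (E k))%:E =
      \int[P]_w \sum_k (wt k * \1_(E k) w)%:E)%E.
    rewrite ge0_integral_sum //.
    - apply: eq_bigr => k _; rewrite EFinM -prE //.
      rewrite -[in LHS](setIT (E k)) -integral_indic // -ge0_integralZl_EFin //.
      by apply/measurable_EFinP; exact: measurable_indic.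
    - by move=> k w _; rewrite lee_fin mulr_ge0 // ler0n.
  rewrite unlock -ge0_integralD //; first last.
  - exact: emeasurable_sum.
  - by move=> w _; apply: sume_ge0 => k _; rewrite lee_fin mulr_ge0 // ler0n.
  - exact/measurable_EFinP.
  have -> : (L%:R%:E = \int[P]_w (L%:R%:E))%E.
    by rewrite integral_cst //= probability_setT mule1.
  apply: ge0_le_integral => //.
  - apply: emeasurable_funD; first exact/measurable_EFinP.
    exact: emeasurable_sum.
  - move=> w _; rewrite sumEFin -EFinD lee_fin.
    have := self_intersection_time_lower (fun t => X t w) L.
    rewrite -(ler_nat R) natrD natr_sum => /le_trans; apply.
    rewrite lerD2l; apply: ler_sum => k _.
    have -> : \1_(E k) w = (X (k.1.+1 + k.2)%N w == X k.1 w)%:R :> R.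
      by rewrite indicE; congr (_ _)%:R; apply/idP/eqP; rewrite inE.
    by rewrite natrM mulrC.
rewrite sumEFin in int_time.
rewrite -/time; move: int_time.
have -> : L%:R%:E = ((L%:R / 2)%:E + (L%:R / 2)%:E)%E :> \bar R.
  by rewrite -EFinD -splitr.
set I := ('E_P[_])%E => int_time.
rewrite -(@leeD2rE _ (L%:R / 2)%:E) //.
apply: le_trans int_time _; rewrite leeD2l // lee_fin //.
Qed.

End WalkProbability.

(** * Connected components, and the existence of large graphs *)

Section Component.
Context (G : sgraph) (v0 : G).

Definition component : finType := {x : G | connect (@adj G) v0 x}.

Definition component_adj : rel component := fun x y => adj (val x) (val y).

Lemma component_adj_sym : symmetric component_adj.
Proof. by move=> x y; exact: adj_sym. Qed.

Lemma component_adj_irrefl : irreflexive component_adj.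
Proof. by move=> x; exact: adj_irrefl. Qed.

Definition component_graph : sgraph :=
  SGraph component_adj_sym component_adj_irrefl.

Lemma nbhd_component (x : component_graph) :
  nbhd (val x) = [set val y | y in nbhd x].
Proof.
apply/setP => y; apply/idP/imsetP => [|[w]];
  last by rewrite inE => xw ->; rewrite inE.
rewrite inE => xy; have v0y : connect (@adj G) v0 y.
  by apply: connect_trans (valP x) _; exact: connect1.
by exists (Sub y v0y : component); rewrite ?inE /= /component_adj ?SubK.
Qed.

Lemma component_regular k :
  regular_graph k G -> regular_graph k component_graph.
Proof.
by move=> G_reg x; rewrite -(G_reg (val x)) nbhd_component card_imset //.
Qed.

Lemma component_connected : connected_graph component_graph.
Proof.
split; first by apply/card_gt0P; exists (Sub v0 (connect0 _ _) : component).
have sub_path s (x : component) : path (@adj G) (val x) s ->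
    exists2 y : component, val y = last (val x) s & connect component_adj x y.
  elim: s x => [|w s IHs] x /=; first by exists x.
  move=> /andP[xw ws]; have v0w : connect (@adj G) v0 w.
    by apply: connect_trans (valP x) _; exact: connect1.
  have [y yE wy] := IHs (Sub w v0w : component) ws.
  exists y => //; apply: connect_trans wy; exact: connect1.
move=> v w; have : connect (@adj G) (val v) (val w).
  apply: connect_trans (valP w).
  by rewrite (sym_connect_sym (@adj_sym G)); exact: valP v.
case/connectP => s /sub_path[y yE vy] wE.
by rewrite (_ : w = y) //; apply: val_inj; rewrite yE.
Qed.

Lemma component_green (R : realFieldType) (p : nat) (z : R) (g : G -> G -> R) :
  is_green p z g ->
  is_green p z (fun x y : component_graph => g (val x) (val y)).
Proof.
move=> g_green x v; rewrite -val_eqE -g_green /resolvent nbhd_component.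
by rewrite big_imset // => y w _ _; exact: val_inj.
Qed.

End Component.

Section Existence.
Context (R : realType) (p : nat).
Hypothesis p_ge5 : (4 < p)%N.

(** The maximisation needs one regular graph to start from: here, [m] disjoint
copies of the complete graph on [p + 2] vertices. *)
Lemma clique_table m : exists e : edge_table #|{: 'I_m * 'I_p.+2}|,
  is_regular_table p e.
Proof.
pose f : 'I_#|{: 'I_m * 'I_p.+2}| -> 'I_m * 'I_p.+2 := enum_val.
exists [ffun xy => ((f xy.1).1 == (f xy.2).1) && ((f xy.1).2 != (f xy.2).2)].
apply/is_regular_tableP; split.
- by move=> x y; rewrite !ffunE /= eq_sym [_.2 == _]eq_sym.
- by move=> x; rewrite ffunE /= !eqxx.
- move=> x.
  pose D := finset.setX [set (f x).1]%SET [set~ (f x).2]%SET.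
  transitivity #|f @^-1: D|.
    apply: eq_card => y; rewrite !inE ffunE /=.
    by rewrite eq_sym [X in _ && ~~ X]eq_sym.
  rewrite on_card_preimset; last by apply: onW_bij; exact: enum_val_bij.
  by rewrite cardsX cards1 cardsC1 card_ord mul1n.
Qed.

(** [L] is taken as a multiple of [p + 2], so that the number of vertices
[9 L^2] is one for which [clique_table] applies. *)
Lemma exists_large_walk_graph (m : nat) : exists G : sgraph,
  (m < #|G|)%N /\ connected_graph G /\ regular_graph p.+1 G /\
  forall (u : G) (d : measure_display) (Omega : measurableType d)
         (P : probability Omega R) (X : nat -> Omega -> G),
    nonbacktracking_walk P u X ->
    ((Num.sqrt #|G|%:R / 6)%:E <=
       'E_P[fun w => (self_intersection_time (fun t => X t w))%:R])%E.
Proof.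
pose l := (10 + m)%N; pose L := (p.+2 * l)%N.
have L0 : (0 < L)%N by rewrite /L /l; lia.
have LR : 1 <= L%:R :> R by rewrite ler1n.
have p0 : (0 < p)%N by lia.
have pR : 0 < p%:R :> R by rewrite ltr0n.
pose z : R := (1 - L%:R^-1) / p%:R.
have pzE : p%:R * z = 1 - L%:R^-1 by rewrite /z mulrCA divff ?mulr1 // gt_eqF.
have L2 : 2 <= L%:R :> R by rewrite ler_nat /L /l; nia.
have invL : 0 < L%:R^-1 :> R by rewrite invr_gt0; lra.
have invL1 : L%:R^-1 < 1 :> R by rewrite invf_lt1; lra.
have z0 : 0 < z by rewrite divr_gt0 // subr_gt0.
have pz1 : p%:R * z < 1 by rewrite pzE; lra.
have [e0 e0_reg] := clique_table (9 * p.+2 * l ^ 2).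
have [e [e_reg stable]] := extremal_table_stable p0 z0 pz1 e0_reg.
pose G0 := table_graph e_reg.
have G0_reg : regular_graph p.+1 G0 by exact: table_graph_regular.
pose g (x y : G0) : R := table_green z x y.
have g_green : is_green p z g by exact: table_greenP.
have cardG0 : #|G0| = (9 * L ^ 2)%N.
  by rewrite card_ord card_prod !card_ord /L; ring.
have eps_le : forall x : G0, vertex_excess z g x <= (L%:R + 1)^-1.
  apply: (stable_vertex_excess_le G0_reg p_ge5 z0 pz1 g_green _ stable).
  - exact: table_green_sym.
  - by rewrite /L /l; nia.
  - by rewrite pzE opprB addrC subrK.
  - by rewrite cardG0 natrM natrX.
have [v0 _] : exists v0 : G0, v0 \in [set: G0].
  by apply/card_gt0P; rewrite cardsT cardG0 muln_gt0 expn_gt0 L0.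
have H_green := component_green (v0 := v0) g_green.
have H_reg := component_regular (v0 := v0) G0_reg.
exists (component_graph v0); split.
  have card_le := green_card H_reg p0 z0 pz1 H_green
    (Sub v0 (connect0 _ _) : component v0).
  have le2 : 1 + vertex_excess z g v0 <= 2.
    have : (L%:R + 1)^-1 <= 1 :> R by rewrite invf_le1; lra.
    by have := eps_le v0; lra.
  have : (L <= 2 * #|component_graph v0|)%N.
    rewrite -(ler_nat R) natrM; set N : R := #|_|%:R in card_le *.
    have N0 : 0 <= N * L%:R^-1 by rewrite mulr_ge0 ?ler0n // ltW.
    have {}card_le : 1 <= N * L%:R^-1 * 2.
      apply: le_trans (ler_wpM2l N0 le2).
      rewrite pzE opprB addrCA subrr addr0 in card_le.
      by apply: le_trans card_le; lra.
    by rewrite mulrAC ler_pdivlMr in card_le; lra.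
  by rewrite /L /l; nia.
split; first exact: component_connected.
split=> // u d Omega P X X_nbw.
have L1 : 0 < L%:R + 1 :> R by lra.
have := @expected_self_intersection_time_ge _ _ _ _ _ H_reg p0 z0 pz1 H_green
  _ _ _ _ _ X_nbw (L%:R + 1)^-1 (fun v => eps_le (val v)) L L0 pzE.
rewrite divff ?gt_eqF // => /(_ (lexx _)); apply: le_trans.
rewrite lee_fin.
have : Num.sqrt #|component_graph v0|%:R <= 3 * L%:R :> R.
  rewrite -[leRHS]ger0_norm; last by lra.
  rewrite -sqrtr_sqr; apply: ler_wsqrtr.
  rewrite (_ : (3 * L%:R) ^+ 2 = #|G0|%:R); last first.
    by rewrite cardG0 natrM natrX; ring.
  rewrite ler_nat; apply: (leq_card (val : component v0 -> G0)); exact: val_inj.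
lra.
Qed.

End Existence.

Theorem theorem3 (R : realType) (p : nat) (p_prime : prime p)
    (p_mod4 : p = 1 %[mod 4]) :
  exists G : nat -> sgraph,
    (forall k, (#|G k| < #|G k.+1|)%N) /\
    (forall k,
      connected_graph (G k) /\
      regular_graph p.+1 (G k) /\
      forall (u : G k) (d : measure_display) (Omega : measurableType d)
             (P : probability Omega R) (X : nat -> Omega -> G k),
        nonbacktracking_walk P u X ->
        ((Num.sqrt #|G k|%:R / 6)%:E <=
           'E_P[fun w => (self_intersection_time (fun t => X t w))%:R])%E).
Proof.
have p_ge5 : (4 < p)%N.
  by move: p_prime p_mod4; case: p => [|[|[|[|[|q]]]]].
have [F F_good] := choice (exists_large_walk_graph R p_ge5).
pose next (G : sgraph) := F #|G|.
exists (fun k => iter k next (F 0%N)); split=> [k|k].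
  by rewrite iterS; have [] := F_good #|iter k next (F 0%N)|.
case: k => [|k]; first by have [] := F_good 0%N.
by rewrite iterS; have [] := F_good #|iter k next (F 0%N)|.
Qed.
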